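(* Let $H$ be a complex Hilbert space, let $\mathcal{H}$ be a unitary realisation of the dual space $H^*$ with duality pairing $\langle\cdot,\cdot\rangle$ on $\mathcal{H}\times H$, and let $a(\cdot,\cdot)$ be a continuous sesquilinear form on $H\times H$. Let $W\subset H$ and $W_j\subset H$, for $j\in\mathbb{N}$, be closed subspaces such that $W_j$ Mosco-converges to $W$ as $j\to\infty$. Let $a$ be compactly perturbed coercive and invertible on $W$. Then there exists $J\in\mathbb{N}$ such that $a$ is uniformly invertible on $W_j$ for $j\ge J$. Further, if, for some $f\in\mathcal{H}$, $u_W\in W$ denotes the solution of $a(u_W,v)=\langle f,v\rangle$ for all $v\in W$ and, for $j\ge J$, $u_{W_j}\in W_j$ denotes the solution of $a(u_{W_j},v)=\langle f,v\rangle$ for all $v\in W_j$, then $\|u_{W_j}-u_W\|_H\to0$ as $j\to\infty$.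
   Context: The dual space $H^*$ is the space of continuous anti-linear functionals on $H$ with the operator norm. A Hilbert space $\mathcal{H}$ together with a continuous sesquilinear form $\langle\cdot,\cdot\rangle$ on $\mathcal{H}\times H$ (the duality pairing) is a unitary realisation of $H^*$ if $\phi\mapsto\ell_\phi$, $\ell_\phi(\psi)=\langle\phi,\psi\rangle$, is a unitary (i.e. isometric linear) isomorphism from $\mathcal{H}$ onto $H^*$. For a closed subspace $W\subset H$, let $W^{a,\mathcal{H}}=\{\psi\in\mathcal{H}:\langle\psi,\phi\rangle=0\ \forall\phi\in W\}$ and $\mathcal{W}=(W^{a,\mathcal{H}})^\perp\subset\mathcal{H}$; $\mathcal{W}$ is a unitary realisation of $W^*$ with the restricted pairing. A sesquilinear form $a$ on $H\times H$ is continuous if $|a(u,v)|\le C\|u\|_H\|v\|_H$ for some $C>0$; coercive if for some $\alpha>0$, $|a(u,u)|\ge\alpha\|u\|_H^2$ for all $u\in H$; compact if $a(u_j,v_j)\to a(u,v)$ whenever $u_j\rightharpoonup u$ and $v_j\rightharpoonup v$ weakly in $H$ (equivalently, the associated operator $A:H\to\mathcal{H}$ with $a(u,v)=\langle Au,v\rangle$ is compact); compactly perturbed coercive if $a=a_0+a_1$ with $a_0$ a coercive and $a_1$ a compact (continuous sesquilinear) form. $a$ is invertible on a closed subspace $W$ if for every $f\in\mathcal{W}$ there is exactly one $u\in W$ with $a(u,v)=\langle f,v\rangle$ for all $v\in W$. $a$ is uniformly invertible on a sequence $(W_j)$ of closed subspaces if $a$ is invertible on each $W_j$ and there is $C>0$,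 independent of $j$, such that for all $j$ and all $f_j\in\mathcal{W}_j=(W_j^{a,\mathcal{H}})^\perp$ the solution $u_{W_j}\in W_j$ of $a(u_{W_j},v)=\langle f_j,v\rangle$ for all $v\in W_j$ satisfies $\|u_{W_j}\|_H\le C\|f_j\|_{\mathcal{H}}$. Mosco convergence: closed subspaces $W_j$ of $H$ Mosco-converge to a closed subspace $W$ if (i) for every $w\in W$ there exist $w_j\in W_j$ with $\|w_j-w\|_H\to0$; and (ii) if $(W_{j_m})$ is a subsequence of $(W_j)$, $w_m\in W_{j_m}$ for $m\in\mathbb{N}$, and $w_m\rightharpoonup w$ weakly in $H$ as $m\to\infty$, then $w\in W$. *)

(* Defs.v *)
From HB Require Import structures.
From mathcomp Require Import all_boot all_order all_algebra.
From mathcomp Require Import complex.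
From mathcomp Require Import all_classical all_reals all_analysis.

Set Implicit Arguments.
Unset Strict Implicit.
Unset Printing Implicit Defensive.

Import Order.TTheory GRing.Theory Num.Theory.
Import numFieldNormedType.Exports.

Local Open Scope classical_set_scope.
Local Open Scope ring_scope.
Local Open Scope complex_scope.

(* [numFieldType]s carry the norm topology, but canonical inference does not
   find it on the concrete type [R[i]]. *)
HB.instance Definition _ (R : rcfType) := NormedModule.copy R[i] R[i]^o.

(* Linear in the first variable, anti-linear in the second. *)
Notation sesquilinear U V :=
  {bilinear U -> V -> _ | *%R & (Num.conj \; *%R)}.

HB.mixin Record NormedModule_isHilbert (R : realType) H
    & CompleteNormedModule R[i] H := {
  inner : {dot H for Num.conj} ;
  inner_normE : forall u : H, inner u u = `|u| ^+ 2
}.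

#[short(type="hilbertType")]
HB.structure Definition Hilbert (R : realType) :=
  {H of CompleteNormedModule R[i] H & NormedModule_isHilbert R H}.

Section Forms.
Context {R : realType} {U V : hilbertType R}.

Definition continuous_form (a : sesquilinear U V) : Prop :=
  exists2 C : R, 0 < C & forall u v, `|a u v| <= C%:C * `|u| * `|v|.

End Forms.

Section Duality.
Context {R : realType} {H : hilbertType R}.

Definition in_dual (l : {linear H -> R[i] | Num.conj \; *%R}) : Prop :=
  continuous l.

Definition opnorm (l : H -> R[i]) : R :=
  sup [set Normc.normc (l v) | v in [set v : H | `|v| <= 1]].

Definition weak_cvg (u_ : nat -> H) (u : H) : Prop :=
  forall l : {linear H -> R[i] | Num.conj \; *%R}, in_dual l ->
    l (u_ j) @[j --> \oo] --> l u.

Definition closed_subspace (W : set H) : Prop :=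
  submod_closed [in W] /\ closed W.

Definition orthogonal_complement (S : set H) : set H :=
  [set u | forall v, S v -> inner u v = 0].

Definition coercive (a : sesquilinear H H) : Prop :=
  exists2 alpha : R, 0 < alpha & forall u, alpha%:C * `|u| ^+ 2 <= `|a u u|.

Definition compact_form (a : sesquilinear H H) : Prop :=
  forall (u_ v_ : nat -> H) (u v : H), weak_cvg u_ u -> weak_cvg v_ v ->
    a (u_ j) (v_ j) @[j --> \oo] --> a u v.

Definition compactly_perturbed_coercive (a : sesquilinear H H) : Prop :=
  exists a0 a1 : sesquilinear H H,
    [/\ forall u v, a u v = a0 u v + a1 u v,
        continuous_form a0 /\ coercive a0
      & continuous_form a1 /\ compact_form a1].

Definition Mosco_cvg (W_ : nat -> set H) (W : set H) : Prop :=
  (forall w, W w ->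
     exists2 w_ : nat -> H, forall j, W_ j (w_ j) & w_ @ \oo --> w) /\
  (forall (j_ : nat -> nat) (w_ : nat -> H) (w : H), increasing_seq j_ ->
     (forall m, W_ (j_ m) (w_ m)) -> weak_cvg w_ w -> W w).

End Duality.

Section Realisation.
Context {R : realType} {H HH : hilbertType R}.
Variable pairing : sesquilinear HH H.

(* [phi |-> pairing phi] maps [HH] isometrically onto [H^*]; its linearity is
   that of [pairing] in the first variable. *)
Definition unitary_realisation : Prop :=
  [/\ continuous_form pairing,
      forall phi, in_dual (pairing phi),
      forall phi, (opnorm (pairing phi))%:C = `|phi|
    & forall l : {linear H -> R[i] | Num.conj \; *%R}, in_dual l ->
        exists phi, forall v, pairing phi v = l v].

Definition annihilator (W : set H) : set HH :=
  [set psi | forall phi, W phi -> pairing psi phi = 0].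

(* Written [calligraphic W] for a closed subspace [W]: with the restricted
   pairing it is a unitary realisation of [W^*]. *)
Definition dual_realisation (W : set H) : set HH :=
  orthogonal_complement (annihilator W).

Definition is_solution (a : sesquilinear H H) (W : set H) (f : HH) (u : H) :
    Prop :=
  W u /\ forall v, W v -> a u v = pairing f v.

Definition invertible_on (a : sesquilinear H H) (W : set H) : Prop :=
  forall f, dual_realisation W f -> exists! u, is_solution a W f u.

Definition uniformly_invertible_on (a : sesquilinear H H)
    (W_ : nat -> set H) : Prop :=
  (forall j, invertible_on a (W_ j)) /\
  exists2 C : R, 0 < C &
    forall j f u, dual_realisation (W_ j) f -> is_solution a (W_ j) f u ->
      `|u| <= C%:C * `|f|.

End Realisation.

(* Main.v *)
Require Import Defs.
From HB Require Import structures.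
From mathcomp Require Import all_boot all_order all_algebra.
From mathcomp Require Import complex.
From mathcomp Require Import all_classical all_reals all_analysis.
From mathcomp Require Import ring lra.

Import Order.TTheory GRing.Theory Num.Theory.
Import numFieldNormedType.Exports.

Local Open Scope classical_set_scope.
Local Open Scope ring_scope.

(* Everything rests on a lower bound, uniform in [j >= J] and [u] in [W_ j]:
   [c * |u|] is at most the norm of [a u] restricted to [W_ j]. If it failed,
   there would be unit vectors [w_k] in [W_ j_k], with [j_k] increasing, such
   that [a w_k] restricted to [W_ j_k] tends to [0]. Pass to a weakly convergent
   subsequence: its limit [w] lies in [W] by the second half of Mosco
   convergence, and [a w] vanishes on [W] by the first half, so [w = 0] by
   invertibility on [W]. But then [a1 w_k w_k --> 0], hence [a0 w_k w_k --> 0],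
   against coercivity. The same argument applied to the adjoint form, whose
   injectivity on [W] comes from the surjectivity of [a], gives surjectivity on
   [W_ j] without any Fredholm theory. For the convergence of the solutions, the
   residual functional [f - a u] vanishes on [W]; the same extraction of weak
   limits shows that its norm on [W_ j] tends to [0], and the lower bound turns
   this into [u_ j --> u]. *)

(** * Convergence in complex normed spaces *)

Section RealNorm.
Context {R : realType}.
Implicit Types V : normedModType R[i].

(* [`|v|] lives in the partially ordered [R[i]]; its real copy gives access to
   total order and real arithmetic. *)
Definition rnorm {V} (v : V) : R := complex.Re `|v|.

Lemma ge0_ReE (z : R[i]) : 0 <= z -> z = (complex.Re z)%:C%C.
Proof. by case: z => x y; rewrite lecE /= => /andP[/eqP-> _]. Qed.

Lemma rnormE {V} (v : V) : `|v| = (rnorm v)%:C%C.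
Proof. exact: ge0_ReE. Qed.

Lemma rnorm_ge0 {V} (v : V) : 0 <= rnorm v.
Proof. by have := normr_ge0 v; rewrite rnormE lecR. Qed.
Hint Extern 0 (is_true (0 <= rnorm _)) => exact: rnorm_ge0 : core.

Lemma rnormD {V} (u v : V) : rnorm (u + v) <= rnorm u + rnorm v.
Proof. by rewrite -lecR rmorphD /= -!rnormE ler_normD. Qed.

Lemma rnormN {V} (u : V) : rnorm (- u) = rnorm u.
Proof. by rewrite /rnorm normrN. Qed.

Lemma rnormC {V} (u v : V) : rnorm (u - v) = rnorm (v - u).
Proof. by rewrite /rnorm distrC. Qed.

Lemma rnorm0 {V} : rnorm (0 : V) = 0.
Proof. by rewrite /rnorm normr0. Qed.

Lemma rnorm_eq0 {V} (v : V) : rnorm v = 0 -> v = 0.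
Proof. by move=> v0; apply/normr0_eq0; rewrite rnormE v0. Qed.

Lemma rnormZ {V} (c : R[i]) (v : V) : rnorm (c *: v) = rnorm c * rnorm v.
Proof.
by apply: (@complexI R); rewrite rmorphM /= -!rnormE normrZ.
Qed.

Lemma rnormM (c d : R[i]) : rnorm (c * d) = rnorm c * rnorm d.
Proof. exact: rnormZ. Qed.

Lemma rnormR (x : R) : 0 <= x -> rnorm (x%:C)%C = x.
Proof. by move=> x0; rewrite /rnorm ger0_norm ?lecR. Qed.

Lemma rnorm_conj (c : R[i]) : rnorm (Num.conj c) = rnorm c.
Proof. by rewrite /rnorm norm_conjC. Qed.

Lemma rnorm_sqrC (c : R[i]) : ((rnorm c ^+ 2)%:C)%C = c * Num.conj c.
Proof. by rewrite rmorphXn /= -rnormE; exact: normCK. Qed.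

Lemma rnorm_cvgP {V} {T : Type} {F : set_system T} {FF : Filter F}
    (f : T -> V) (u : V) :
  f @ F --> u <->
  forall e : R, 0 < e -> \forall t \near F, rnorm (u - f t) < e.
Proof.
split=> [/cvgrPdist_lt uu e e0|uu].
  have {uu} := uu (e%:C)%C; rewrite ltcR => /(_ e0); apply: filterS => t.
  by rewrite rnormE ltcR.
apply/cvgrPdist_lt => e e0; rewrite (ge0_ReE e (ltW e0)).
have /uu : 0 < complex.Re e by rewrite -ltcR -(ge0_ReE e) ?ltW.
by apply: filterS => t; rewrite rnormE ltcR.
Qed.

Lemma cvg_ext {V : topologicalType} {T : Type} {F : set_system T}
    (f g : T -> V) (l : V) : f =1 g -> f @ F --> l -> g @ F --> l.
Proof. by move=> /funext->. Qed.

Lemma rnorm_cvg_le {V V' : normedModType R[i]} {T : Type} {F : set_system T}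
    {FF : Filter F} (f : T -> V) u (g : T -> V') v (C : R) :
  (forall t, rnorm (u - f t) <= C * rnorm (v - g t)) ->
  g @ F --> v -> f @ F --> u.
Proof.
move=> le /rnorm_cvgP gv; apply/rnorm_cvgP => e e0.
(* [C] may be zero or negative; [|C| + 1] is a positive upper bound for it by which one can
   divide. *)
have C1 : 0 < `|C| + 1 by rewrite ltr_wpDl.
have := gv (e / (`|C| + 1)) (divr_gt0 e0 C1).
apply: filterS => t; rewrite ltr_pdivlMr // => lte.
apply: le_lt_trans (le t) (le_lt_trans _ lte).
by rewrite mulrC ler_wpM2l // (le_trans (ler_norm _)) // lerDl.
Qed.

Lemma cvg_lincomb {T : Type} {F : set_system T} {FF : Filter F} (c : R[i])
    (f g : T -> R[i]) (a b : R[i]) : f @ F --> a -> g @ F --> b ->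
  c * f t + g t @[t --> F] --> c * a + b.
Proof. by move=> fa gb; apply: cvgD gb; exact: cvgMr fa. Qed.

Lemma near_inv_lt (e : R) : 0 < e -> \forall n \near \oo, n.+1%:R^-1 < e.
Proof.
by move=> e0; near=> n; near: n; exact: near_infty_natSinv_lt (PosNum e0).
Unshelve. all: by end_near. Qed.

Lemma rnorm_cvg_inv {V} (u_ : nat -> V) u :
  (forall n, rnorm (u - u_ n) <= n.+1%:R^-1) -> u_ @ \oo --> u.
Proof.
move=> le; apply/rnorm_cvgP => e /near_inv_lt; apply: filterS => n.
exact: le_lt_trans.
Qed.

Lemma closed_seqP {V} (A : set V) :
  closed A <-> forall u_ u, (forall n, A (u_ n)) -> u_ @ \oo --> u -> A u.
Proof.
split=> [clA u_ u Au uu|Aseq u clu].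
  exact: (closed_cvg A clA (nearW _ Au) u uu).
have /choice[u_ Au] : forall n, exists v, A v /\ rnorm (u - v) <= n.+1%:R^-1.
  move=> n; have n0 : 0 < (n.+1%:R^-1 : R)%:C%C by rewrite ltcR.
  have [v [Av]] := clu _ (nbhsx_ballx u _ n0).
  rewrite -ball_normE /= rnormE ltcR => /ltW uv.
  by exists v.
apply: (Aseq u_) => [n|]; first by have [] := Au n.
by apply: rnorm_cvg_inv => n; have [] := Au n.
Qed.

Lemma rnorm_cauchy_cvg {V : completeNormedModType R[i]} (u_ : nat -> V) :
  (forall e : R, 0 < e -> exists N, forall n m, (N <= n)%N -> (N <= m)%N ->
     rnorm (u_ n - u_ m) < e) ->
  exists u : V, u_ @ \oo --> u.
Proof.
move=> cau; suff cu : [cvg (u_ @ \oo) in V] by exists (lim (u_ @ \oo)).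
apply/cauchy_cvgP/cauchy_exP => e e0; rewrite (ge0_ReE e (ltW e0)).
have /cau[N Nu] : 0 < complex.Re e by rewrite -ltcR -(ge0_ReE e) ?ltW.
exists (u_ N), N => // n /= Nn.
by rewrite -ball_normE /= rnormE ltcR; exact: Nu.
Qed.

Lemma lipschitz_continuous (V V' : normedModType R[i]) (f : V -> V') (C : R) :
  (forall u v, rnorm (f u - f v) <= C * rnorm (u - v)) -> continuous f.
Proof. by move=> lip u; apply: rnorm_cvg_le (lip u) _. Qed.

Lemma rnorm_Re (z : R[i]) : `|complex.Re z| <= rnorm z.
Proof. by rewrite -lecR -rnormE; exact: normc_ge_Re. Qed.

Lemma rnorm_i : rnorm ('i : R[i])%C = 1.
Proof. by rewrite /rnorm normc_def /= expr0n expr1n add0r sqrtr1. Qed.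

Lemma rnorm_Im (z : R[i]) : `|complex.Im z| <= rnorm z.
Proof.
have := rnorm_Re ('i%C * z); rewrite rnormM rnorm_i mul1r.
by case: z => x y /=; rewrite mul0r mul1r sub0r normrN.
Qed.

Lemma rnorm_le_ReIm (z : R[i]) :
  rnorm z <= `|complex.Re z| + `|complex.Im z|.
Proof.
rewrite [X in rnorm X]complexE (le_trans (rnormD _ _)) // rnormM rnorm_i mul1r.
have absE (x : R) : rnorm (x%:C)%C = `|x|.
  by rewrite /rnorm normc_def /= expr0n addr0 sqrtr_sqr.
by rewrite !absE.
Qed.

End RealNorm.
#[export] Hint Extern 0 (is_true (0 <= rnorm _)) => exact: rnorm_ge0 : core.

(** * Hilbert spaces *)

Section Hilbert.
Context {R : realType} {H : hilbertType R}.
Implicit Types (u v w : H) (W : set H).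

Lemma closed_subspaceP W :
  closed_subspace W <-> [/\ W 0,
    forall c u v, W u -> W v -> W (c *: u + v)
  & forall (u_ : nat -> H) u, (forall n, W (u_ n)) -> u_ @ \oo --> u -> W u].
Proof.
split=> [[[W0 lW] /closed_seqP clW]|[W0 lW clW]]; split=> //.
- by rewrite inE in W0.
- by move=> c u v Wu Wv; have := lW c u v; rewrite !inE; exact.
- by split=> [|c u v]; rewrite !inE //; exact: lW.
- exact/closed_seqP.
Qed.

Lemma closed_subspaceB W u v : closed_subspace W -> W u -> W v -> W (u - v).
Proof.
by move=> /closed_subspaceP[_ lW _] Wu Wv; rewrite -scaleN1r addrC; exact: lW.
Qed.

Lemma closed_subspaceD W u v : closed_subspace W -> W u -> W v -> W (u + v).
Proof.
by move=> /closed_subspaceP[_ lW _] Wu Wv; rewrite -[u]scale1r; exact: lW.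
Qed.

Lemma closed_subspaceZ W c u : closed_subspace W -> W u -> W (c *: u).
Proof.
by move=> /closed_subspaceP[W0 lW _] Wu; rewrite -[_ *: _]addr0; exact: lW.
Qed.

Lemma inner_rnorm u : inner u u = ((rnorm u ^+ 2)%:C)%C.
Proof. by rewrite inner_normE rnormE rmorphXn. Qed.

Lemma inner_conj u v : inner u v = Num.conj (inner v u).
Proof. by rewrite hermC expr0 mul1r. Qed.

Lemma rnorm_inner_sym u v : rnorm (inner u v) = rnorm (inner v u).
Proof. by rewrite inner_conj rnorm_conj. Qed.

(** Pythagoras for the component of [u] orthogonal to [v]. Nonnegativity of the left side gives
    Cauchy-Schwarz; in [projection] the same identity measures how much a correction along [v]
    shortens a distance. *)
Lemma rnorm_residual u v : v != 0 ->
  rnorm (u - (inner u v / inner v v) *: v) ^+ 2 =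
  rnorm u ^+ 2 - rnorm (inner u v) ^+ 2 / rnorm v ^+ 2.
Proof.
move=> v0; have nv0 : inner v v != 0 by rewrite dnorm_eq0.
have nvC : Num.conj (inner v v) = inner v v by rewrite -inner_conj.
have E : inner (u - (inner u v / inner v v) *: v)
      (u - (inner u v / inner v v) *: v) =
    inner u u - inner u v * Num.conj (inner u v) / inner v v.
  set t := inner u v / inner v v.
  have tC : Num.conj t = Num.conj (inner u v) / inner v v.
    by rewrite fmorph_div /= nvC.
  rewrite dnormB dnormZ linearZr_LR /= normCK tC rmorphM /= -tC conjCK tC /t.
  by field.
apply: (@complexI R); rewrite rmorphB fmorph_div -!inner_rnorm E /=.
by rewrite rnorm_sqrC !inner_rnorm.
Qed.

Lemma cauchy_schwarz u v : rnorm (inner u v) <= rnorm u * rnorm v.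
Proof.
have [->|v0] := eqVneq v 0; first by rewrite linear0r !rnorm0 mulr0.
have nv0 : 0 < rnorm v.
  by rewrite lt_def rnorm_ge0 andbT; apply: contra_neq v0; exact: rnorm_eq0.
have := sqr_ge0 (rnorm (u - (inner u v / inner v v) *: v)).
rewrite rnorm_residual // subr_ge0 ler_pdivrMr ?exprn_gt0 // -exprMn.
by rewrite ler_pXn2r ?nnegrE ?mulr_ge0.
Qed.

Lemma parallelogram u v :
  rnorm (u + v) ^+ 2 + rnorm (u - v) ^+ 2 = 2 * rnorm u ^+ 2 + 2 * rnorm v ^+ 2.
Proof.
apply: (@complexI R); rewrite !mulr_natl !mulr2n !rmorphD /= -!inner_rnorm.
by rewrite dnormD dnormB !inner_rnorm; ring.
Qed.

Lemma inner_cvgl v (u_ : nat -> H) u :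
  u_ @ \oo --> u -> inner (u_ n) v @[n --> \oo] --> inner u v.
Proof.
apply: (@rnorm_cvg_le _ _ _ _ _ _ _ _ _ _ (rnorm v)) => n.
by rewrite -linearBl mulrC cauchy_schwarz.
Qed.

Lemma inner_continuous u : continuous (inner u).
Proof.
have lip := @lipschitz_continuous _ H R[i]^o (inner u) (rnorm u).
apply: lip => v w; by rewrite -linearBr cauchy_schwarz.
Qed.

(** A minimising sequence for the distance from [u] to [W] is Cauchy by the parallelogram law.
    Orthogonality is obtained along that sequence and passed to the limit [p]. *)
Lemma projection W u : closed_subspace W ->
  exists p, W p /\ orthogonal_complement W (u - p).
Proof.
move=> Wcl; have [W0 lW clW] := (closed_subspaceP _).1 Wcl.
pose S := [set rnorm (u - w) ^+ 2 | w in W].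
have infS : has_inf S.
  split; first by exists (rnorm (u - 0) ^+ 2), 0.
  by exists 0 => _ [w _ <-]; exact: sqr_ge0.
have infle w : W w -> inf S <= rnorm (u - w) ^+ 2.
  by move=> Ww; apply: ge_inf; [case: infS|exists w].
have /choice[w_ w_P] : forall n, exists w, W w /\
    rnorm (u - w) ^+ 2 < inf S + n.+1%:R^-1.
  move=> n; have [|_ [w Ww <-] lt] := @inf_adherent _ S n.+1%:R^-1 _ infS.
    by rewrite invr_gt0.
  by exists w.
have Ww_ n : W (w_ n) by case: (w_P n).
have [p w_p] : exists p : H, w_ @ \oo --> p.
  apply: rnorm_cauchy_cvg => e e0.
  (* The midpoint of [w_ n] and [w_ m] lies in [W], so the parallelogram law bounds the squared
     distance of the two by the excess over [4 * inf S], which is below [4 * (e ^+ 2 / 4)]. *)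
  have e4 : 0 < e ^+ 2 / 4 by rewrite divr_gt0 ?exprn_gt0.
  have [N _ Nlt] := near_inv_lt _ e4; exists N => n m Nn Nm.
  have Nle k : (N <= k)%N -> rnorm (u - w_ k) ^+ 2 < inf S + e ^+ 2 / 4.
    by move=> Nk; apply: lt_trans (w_P k).2 _; rewrite ltrD2l; exact: Nlt.
  have Wmid : W (2^-1 *: (w_ n + w_ m)).
    by apply: closed_subspaceZ => //; exact: closed_subspaceD.
  have := parallelogram (u - w_ n) (u - w_ m).
  have -> : u - w_ n + (u - w_ m) = (2 : R[i]) *: (u - 2^-1 *: (w_ n + w_ m)).
    rewrite scalerBr scalerA divff ?scale1r ?pnatr_eq0 //.
    by rewrite scaler_nat mulr2n opprD addrACA.
  have -> : u - w_ n - (u - w_ m) = w_ m - w_ n.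
    by rewrite opprB addrC addrA subrK.
  rewrite rnormZ (rnormC (w_ m)) exprMn.
  have -> : rnorm (2 : R[i]) = 2.
    by rewrite -[RHS](rnormR 2) // (rmorph_nat (real_complex R)).
  have := infle _ Wmid; have := Nle n Nn; have := Nle m Nm => lt1 lt2 le3 E.
  rewrite -(@ltr_pXn2r _ 2) ?nnegrE ?(ltW e0) //.
  by lra.
exists p; split; first exact: clW w_p.
move=> w Ww; have [->|w0] := eqVneq w 0; first by rewrite linear0r.
have nw0 : 0 < rnorm w.
  by rewrite lt_def rnorm_ge0 andbT; apply: contra_neq w0; exact: rnorm_eq0.
have pw := inner_cvgl w _ _ w_p.
(* Correcting [w_ n] by the optimal multiple of [w] cannot bring the squared distance below [inf S],
   so [|inner (u - w_ n) w|^2 / |w|^2] is less than [1/(n+1)]. *)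
have uw : inner (w_ n) w @[n --> \oo] --> inner u w.
  apply/rnorm_cvgP => e e0.
  have /near_inv_lt : 0 < (e / rnorm w) ^+ 2 by rewrite exprn_gt0 ?divr_gt0.
  apply: filterS => n ltn; rewrite -linearBl.
  have := infle _ (closed_subspaceD _ _ _ Wcl (Ww_ n) (closed_subspaceZ _
    (inner (u - w_ n) w / inner w w) _ Wcl Ww)).
  rewrite opprD addrA rnorm_residual // => le1; have := (w_P n).2 => lt2.
  have lt3 : rnorm (inner (u - w_ n) w) ^+ 2 / rnorm w ^+ 2 < (e / rnorm w) ^+ 2.
    move: le1; rewrite lerBrDr -lerBrDl => le1; apply: le_lt_trans le1 _.
    by rewrite ltrBlDl (lt_trans lt2) ?ltrD2l.
  rewrite -(@ltr_pXn2r _ 2) ?nnegrE ?(ltW e0) //.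
  by rewrite expr_div_n ltr_pM2r ?invr_gt0 ?exprn_gt0 in lt3.
by rewrite linearBl /= (cvg_unique (@norm_hausdorff _ _) uw pw) subrr.
Qed.

(** A predicate on bare functions, so that pointwise limits along an ultrafilter and residuals such
    as [f - a u] count as functionals directly. *)
Definition antilinear (l : H -> R[i]) : Prop :=
  forall c u v, l (c *: u + v) = Num.conj c * l u + l v.

Lemma antilinear_linear (l : {linear H -> R[i] | Num.conj \; *%R}) :
  antilinear l.
Proof. by move=> c u v; rewrite linearP. Qed.

Lemma antilinear0 l : antilinear l -> l 0 = 0.
Proof.
by move=> lin; have := lin 1 0 0; rewrite scale1r addr0 rmorph1 mul1r => /eqP;
  rewrite -subr_eq0 opprD addNKr oppr_eq0 => /eqP.
Qed.

Lemma antilinearB l u v : antilinear l -> l (u - v) = l u - l v.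
Proof.
by move=> lin; rewrite addrC -scaleN1r lin rmorphN1 mulN1r addrC.
Qed.

Lemma antilinear_continuous l (C : R) : antilinear l ->
  (forall v, rnorm (l v) <= C * rnorm v) -> continuous l.
Proof.
move=> lin le; have lip := @lipschitz_continuous _ H R[i]^o l C.
by apply: lip => u v; rewrite -antilinearB.
Qed.

(** Unless [l] is zero, its kernel is a proper closed subspace, and a suitable multiple of a vector
    [q] normal to the kernel represents [l]. *)
Lemma riesz l : antilinear l -> continuous l ->
  exists u, forall v, l v = inner u v.
Proof.
move=> lin lcont; pose K := [set v | l v = 0].
have [l0|/existsNP[v0 /eqP lv0]] := pselect (forall v, l v = 0).
  by exists 0 => v; rewrite linear0l l0.
have Kcl : closed_subspace K.
  apply/closed_subspaceP; split=> [|c u v Ku Kv|u_ u Ku uu]; rewrite /K /=.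
  - exact: antilinear0.
  - by rewrite lin Ku Kv mulr0 addr0.
  - have lu : l (u_ n) @[n --> \oo] --> l u.
      exact: cvg_comp uu (lcont u).
    have l0 : l (u_ n) @[n --> \oo] --> (0 : R[i]).
      rewrite (_ : (fun n => l (u_ n)) = fun=> 0); last exact/funext.
      exact: cvg_cst.
    exact: (cvg_unique (@norm_hausdorff _ _) lu l0).
have [p [Kp ortho]] := projection K v0 Kcl; set q := v0 - p in ortho.
have lq : l q != 0 by rewrite antilinearB // Kp subr0.
have q0 : inner q q != 0.
  by rewrite dnorm_eq0; apply: contra_neq lq => ->; exact: antilinear0.
exists ((l q / inner q q) *: q) => v.
(* Removing this multiple of [q] sends any [v] into the kernel; the conjugate compensates the
   anti-linearity of [l]. *)
have /ortho : K (v - Num.conj (l v / l q) *: q).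
  rewrite /K /= antilinearB // -[_ *: q]addr0 lin antilinear0 // addr0 conjCK.
  by rewrite divfK ?subrr.
rewrite linearBr linearZr_LR /= conjCK => /eqP; rewrite subr_eq0 => /eqP E.
rewrite linearZl_LR /= [X in _ * X]E.
by field; rewrite q0 lq.
Qed.

(** By [riesz] the test functionals are the [inner y]; conjugate symmetry moves the sequence to the
    first slot without changing the norms of differences. *)
Lemma weak_cvgP (u_ : nat -> H) u :
  weak_cvg u_ u <-> forall v, inner (u_ n) v @[n --> \oo] --> inner u v.
Proof.
have sym (f : nat -> R[i]) l g m :
    (forall n, rnorm (l - f n) = rnorm (m - g n)) ->
    g @ \oo --> m -> f @ \oo --> l.
  move=> fg; apply: (@rnorm_cvg_le _ _ _ _ _ _ _ _ _ _ 1) => n.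
  by rewrite mul1r fg.
split=> [wc v|wc l /riesz[|y ly]]; last 2 first.
- exact: antilinear_linear.
- apply: sym (wc y) => n.
  by rewrite !ly -linearBr -linearBl rnorm_inner_sym.
apply: sym (wc _ (inner_continuous v)) => n.
by rewrite -linearBr -linearBl rnorm_inner_sym.
Qed.

Lemma antilinear_weak_cvg l (u_ : nat -> H) u : antilinear l -> continuous l ->
  weak_cvg u_ u -> l (u_ n) @[n --> \oo] --> l u.
Proof.
move=> lin lcont wc; have [y ly] := riesz l lin lcont.
have -> : l = inner y by exact/funext.
exact: wc _ (inner_continuous y).
Qed.

End Hilbert.

(** * Weak sequential compactness *)

Section Ultralimit.
Context {R : realType} {U : set_system nat} {UU : UltraFilter U}.

(** The image ultrafilter clusters in the compact interval [[- M, M]], and an ultrafilter converges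
    to each of its cluster points. *)
Lemma ultra_bounded_cvg (f : nat -> R) (M : R) : (forall n, `|f n| <= M) ->
  exists l : R, f @ U --> l.
Proof.
move=> fM; have UM : U (f @^-1` `[- M, M]).
  by apply: filterE => n; rewrite /= in_itv /= -ler_norml.
have [l [_ clf]] := segment_compact (fmap_proper_filter f ultra_proper) UM.
exists l => A Al; have [//|UA] := in_ultra_setVsetC (f @^-1` A) UU.
by have [y [/= nAy Ay]] := clf (~` A) A UA Al.
Qed.

Lemma ultra_bounded_cvgC (f : nat -> R[i]) (M : R) :
  (forall n, rnorm (f n) <= M) ->
  exists l : R[i], f @ U --> l.
Proof.
move=> fM.
have [x fx] := ultra_bounded_cvg (fun n => complex.Re (f n)) M
  (fun n => le_trans (rnorm_Re _) (fM n)).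
have [y fy] := ultra_bounded_cvg (fun n => complex.Im (f n)) M
  (fun n => le_trans (rnorm_Im _) (fM n)).
exists (x +i* y)%C; apply/rnorm_cvgP => e e0.
have e2 : 0 < e / 2 by rewrite divr_gt0.
have /cvgrPdist_lt/(_ _ e2) Ux := fx; have /cvgrPdist_lt/(_ _ e2) Uy := fy.
apply: filterS2 Ux Uy => n xn yn; apply: le_lt_trans (rnorm_le_ReIm _) _.
by move: xn yn; case: (f n) => a b /= xn yn; rewrite [e]splitr ltrD.
Qed.

End Ultralimit.

Section WeakCompactness.
Context {R : realType} {H : hilbertType R}.

Lemma rnorm_le_cvg {V : normedModType R[i]} {F : set_system nat}
    {FF : ProperFilter F} (f : nat -> V) l (C : R) :
  (forall n, rnorm (f n) <= C) -> f @ F --> l -> rnorm l <= C.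
Proof.
move=> fC /rnorm_cvgP fl; apply/ler_addgt0Pr => e e0.
have [n /= ln] := filter_ex (fl e e0).
by rewrite -(subrK (f n) l) (le_trans (rnormD _ _)) // addrC lerD // ltW.
Qed.

(** The limits of [inner (x_ n) v] exist for all [v] at once along an ultrafilter. They form an
    anti-linear functional bounded by [C], which [riesz] represents. *)
Lemma ultra_weak_limit {U : set_system nat} {UU : UltraFilter U}
    (x_ : nat -> H) (C : R) : (forall n, rnorm (x_ n) <= C) ->
  exists x, forall v, inner (x_ n) v @[n --> U] --> inner x v.
Proof.
move=> xC.
have bnd v n : rnorm (inner (x_ n) v) <= C * rnorm v.
  by rewrite (le_trans (cauchy_schwarz _ _)) // ler_wpM2r.
have /choice[l xl] : forall v, exists l : R[i], inner (x_ n) v @[n --> U] --> l.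
  by move=> v; exact: ultra_bounded_cvgC (bnd v).
have lin : antilinear l.
  move=> c u v; have cuv := @cvg_lincomb _ _ _ (ultra_proper (UltraFilter := UU))
    (Num.conj c) _ _ _ _ (xl u) (xl v).
  have cuv' : inner (x_ n) (c *: u + v) @[n --> U] --> Num.conj c * l u + l v.
    by apply: (cvg_ext _ _ _ _ cuv) => n; rewrite linearDr linearZr_LR.
  exact: (cvg_unique (@norm_hausdorff _ _) (xl _) cuv').
have lcont : continuous l.
  apply: (antilinear_continuous _ C) => // v.
  exact: rnorm_le_cvg (bnd v) (xl v).
by have [x lx] := riesz l lin lcont; exists x => v; rewrite -lx.
Qed.

(** The test vectors [v] that work form a closed subspace [V] containing [x] and every [y_ i]. A
    vector orthogonal to [V] is orthogonal to all of these, so it works trivially and lies in [V]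
    too; hence [V] is everything. *)
Lemma weak_cvg_of_gram (y_ : nat -> H) (C : R) x :
  (forall n, rnorm (y_ n) <= C) ->
  (forall i, inner (y_ n) (y_ i) @[n --> \oo] --> inner x (y_ i)) ->
  inner (y_ n) x @[n --> \oo] --> inner x x ->
  weak_cvg y_ x.
Proof.
move=> yC yy yx; apply/weak_cvgP => v.
pose V := [set v | inner (y_ n) v @[n --> \oo] --> inner x v].
have C0 : 0 <= C by apply: le_trans (yC 0); exact: rnorm_ge0.
have Vcl : closed_subspace V.
  apply/closed_subspaceP; split=> [|c u w Vu Vw|u_ u Vu uu]; rewrite /V /=.
  - rewrite linear0r; have c0 : (fun _ : nat => 0 : R[i]) @ \oo --> (0 : R[i]).
      exact: cvg_cst.
    by apply: (cvg_ext _ _ _ _ c0) => n; rewrite linear0r.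
  - rewrite linearDr linearZr_LR /=.
    have cuw := @cvg_lincomb _ _ _ eventually_filter (Num.conj c) _ _ _ _ Vu Vw.
    apply: (cvg_ext _ _ _ _ cuw) => n.
    by rewrite linearDr linearZr_LR.
  - apply/rnorm_cvgP => e e0; have e2 : 0 < e / 2 by rewrite divr_gt0.
    (* [rnorm x + C] bounds [x - y_ n] uniformly in [n], which controls the error of replacing [u]
       by [u_ m]; the [1] keeps the divisor positive. *)
    have D0 : 0 < rnorm x + C + 1 by rewrite ltr_wpDl ?addr_ge0.
    have /rnorm_cvgP/(_ _ (divr_gt0 e2 D0)) := uu => /filter_ex[m /= um].
    have /rnorm_cvgP/(_ _ e2) := Vu m; apply: filterS => n.
    rewrite -!linearBl /= => ltn.
    rewrite -[u](subrK (u_ m)) linearDr [e]splitr.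
    rewrite (le_lt_trans (rnormD _ _)) // ler_ltD //.
    rewrite (le_trans (cauchy_schwarz _ _)) //.
    move: um; rewrite ltr_pdivlMr // mulrC => /ltW; apply: le_trans.
    rewrite ler_wpM2r // (le_trans (rnormD _ _)) // rnormN.
    by rewrite (le_trans (lerD (lexx _) (yC n))) // lerDl.
have [p [Vp ortho]] := projection V v Vcl.
have orthoC w : V w -> inner w (v - p) = 0.
  by move=> Vw; rewrite inner_conj ortho // rmorph0.
have Vq : V (v - p).
  have c0 : (fun _ : nat => 0 : R[i]) @ \oo --> (0 : R[i]) by exact: cvg_cst.
  rewrite /V /= (orthoC x yx).
  by apply: (cvg_ext _ _ _ _ c0) => n; rewrite (orthoC (y_ n) (yy n)).
by have := closed_subspaceD V _ _ Vcl Vq Vp; rewrite subrK.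
Qed.

Lemma ultra_forall_seq {U : set_system nat} {UU : Filter U} (T : eqType)
    (P : T -> nat -> Prop) (r : seq T) :
  (forall i, U (P i)) -> U [set n | forall i, i \in r -> P i n].
Proof.
move=> UP; elim: r => [|i r IH]; first by apply: filterE.
apply: filterS2 (UP i) IH => n Pin Pr j; rewrite inE => /orP[/eqP->//|].
exact: Pr.
Qed.

(* The weak limit [x] is taken along a nonprincipal ultrafilter; the subsequence
   is then chosen recursively so that its Gram matrix converges to the inner
   products with [x]. The parameter [phi] sets the minimal growth of the
   indices. *)
Lemma bounded_weak_cvg_subseq (x_ : nat -> H) (C : R) (phi : nat -> nat) :
  (forall n, rnorm (x_ n) <= C) ->
  exists (s : nat -> nat) x,
    (forall i k, (i < k)%N -> (phi (s i) < s k)%N) /\ weak_cvg (x_ \o s) x.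
Proof.
move=> xC; have [U [UU infU]] := ultraFilterLemma (F := \oo) _.
have [x xl] := ultra_weak_limit x_ C xC.
have small v (e : R) :
    0 < e -> U [set n | rnorm (inner x v - inner (x_ n) v) < e].
  by move=> e0; have /rnorm_cvgP := xl v; apply.
(* [r] lists the indices already chosen. Finitely many conditions, each holding on a set of [U], are
   met by a common index; the tolerance shrinks with the length of [r]. *)
have /choice[next nextP] : forall r : seq nat, exists n,
    rnorm (inner x x - inner (x_ n) x) < (size r).+1%:R^-1 /\
    forall i, i \in r -> (phi i < n)%N /\
      rnorm (inner x (x_ i) - inner (x_ n) (x_ i)) < (size r).+1%:R^-1.
  move=> r; have r0 : 0 < (size r).+1%:R^-1 :> R by rewrite invr_gt0.
  apply: (@filter_ex _ U); apply: filterI; first exact: small.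
  apply: ultra_forall_seq => i; apply: filterI; last exact: small.
  by apply: infU; exists (phi i).+1.
pose pre := fix pre k := if k is k'.+1 then next (pre k') :: pre k' else [::].
have size_pre k : size (pre k) = k by elim: k => //= k ->.
pose s k := next (pre k).
have s_pre i k : (i < k)%N -> s i \in pre k.
  elim: k => // k IH; rewrite ltnS leq_eqVlt inE => /orP[/eqP->|/IH->].
    by rewrite eqxx.
  by rewrite orbT.
exists s, x; split=> [i k /s_pre ik|].
  by have [_ /(_ _ ik)[]] := nextP (pre k).
apply: (weak_cvg_of_gram _ C) => [n|i|]; first exact: xC.
- apply/rnorm_cvgP => e /near_inv_lt en; near=> n.
  have [_ /(_ (s i))[|_ lt]] := nextP (pre n).
    by apply: s_pre; near: n; exists i.+1.
  by apply: lt_trans lt _; rewrite size_pre; near: n.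
- apply/rnorm_cvgP => e /near_inv_lt; apply: filterS => n; apply: lt_trans.
  by have [+ _] := nextP (pre n); rewrite size_pre.
Unshelve. all: by end_near. Qed.

End WeakCompactness.

(** * Sesquilinear forms *)

Section Forms.
Context {R : realType} {H K : hilbertType R}.
Implicit Types (a : sesquilinear H K).

(** The conjugate makes the swapped form sesquilinear again, so facts about one argument transfer to
    the other. *)
Definition adjoint_form a (v : K) (u : H) : R[i] := Num.conj (a u v).

Lemma adjoint_form_is_bilinear a :
  bilinear_for (GRing.Scale.Law.clone _ _ *%R _)
    (GRing.Scale.Law.clone _ _ (Num.conj \; *%R) _) (adjoint_form a).
Proof.
split=> [u c v w|v c u w]; rewrite /adjoint_form /=.
  by rewrite linearDr linearZr_LR rmorphD rmorphM /= conjCK.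
by rewrite linearDl linearZl_LR rmorphD rmorphM.
Qed.

HB.instance Definition _ a :=
  bilinear_isBilinear.Build R[i] K H R[i] _ _ (adjoint_form a)
    (adjoint_form_is_bilinear a).

Lemma continuous_formP a : continuous_form a ->
  exists2 C : R, 0 < C & forall u v, rnorm (a u v) <= C * rnorm u * rnorm v.
Proof.
move=> [C C0 le]; exists C => // u v; have := le u v.
by rewrite !rnormE -!rmorphM lecR.
Qed.

Lemma antilinear_form a u : antilinear (a u).
Proof. by move=> c v w; rewrite linearDr linearZr_LR. Qed.

Lemma continuous_form_continuous a u : continuous_form a -> continuous (a u).
Proof.
move=> /continuous_formP[C _ le].
by apply: (antilinear_continuous _ (C * rnorm u)) (antilinear_form a u) _.
Qed.

Lemma continuous_adjoint_form a :
  continuous_form a -> continuous_form (adjoint_form a).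
Proof.
move=> [C C0 le]; exists C => // u v.
by rewrite norm_conjC -mulrA (mulrC `|u|) mulrA le.
Qed.

End Forms.

Section FormLimits.
Context {R : realType} {H K : hilbertType R}.
Implicit Types (a : sesquilinear H K).

Lemma form_weak_cvgl a (u_ : nat -> H) u v : continuous_form a ->
  weak_cvg u_ u -> a (u_ n) v @[n --> \oo] --> a u v.
Proof.
move=> acont wc; have cont := continuous_form_continuous (adjoint_form a) v
  (continuous_adjoint_form a acont).
have := antilinear_weak_cvg _ _ _ (antilinear_form (adjoint_form a) v) cont wc.
apply: (@rnorm_cvg_le _ _ _ _ _ _ _ _ _ _ 1) => n.
by rewrite mul1r /adjoint_form -rmorphB rnorm_conj.
Qed.

(** Split [a (u_ n) (v_ n)] into [a (u_ n) (v_ n - v)], small because [u_] is bounded, and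
    [a (u_ n) v], handled by weak convergence. *)
Lemma form_weak_strong_cvg a (M : R) (u_ : nat -> H) u (v_ : nat -> K) v :
  continuous_form a -> (forall n, rnorm (u_ n) <= M) ->
  weak_cvg u_ u -> v_ @ \oo --> v ->
  a (u_ n) (v_ n) @[n --> \oo] --> a u v.
Proof.
move=> acont uM wc vv; have [C C0 le] := continuous_formP a acont.
have auv : a (u_ n) (v_ n) - a (u_ n) v @[n --> \oo] --> (0 : R[i]).
  apply: (@rnorm_cvg_le _ _ _ _ _ _ _ _ v_ v (C * M)) => // n.
  rewrite sub0r rnormN -linearBr (rnormC v) (le_trans (le _ _)) //.
  by rewrite ler_wpM2r // ler_wpM2l // ltW.
have auv' : a (u_ n) (v_ n) - a (u_ n) v + a (u_ n) v @[n --> \oo]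
    --> (0 + a u v : R[i]).
  exact: (cvgD auv (form_weak_cvgl a u_ u v acont wc)).
by rewrite -[a u v]add0r; apply: (cvg_ext _ _ _ _ auv') => n; exact: subrK.
Qed.

End FormLimits.

(** * Mosco convergence *)

Section Mosco.
Context {R : realType} {H : hilbertType R}.
Implicit Types (a : sesquilinear H H).

(** The extraction shared by the contradiction arguments below: [P m j w] records how the unit
    vector [w] of [W_ j] violates the desired bound at stage [m]. *)
Lemma Mosco_weak_limit (W_ : nat -> set H) (W : set H)
    (P : nat -> nat -> H -> Prop) : Mosco_cvg W_ W ->
  (forall m, exists j w, [/\ (m <= j)%N, W_ j w, rnorm w = 1 & P m j w]) ->
  exists (s j_ : nat -> nat) (w_ : nat -> H) w,
    [/\ forall k, (k <= s k)%N, forall k, (k <= j_ k)%N,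
      forall k, [/\ W_ (j_ k) (w_ k), rnorm (w_ k) = 1 & P (s k) (j_ k) (w_ k)],
      weak_cvg w_ w & W w].
Proof.
move=> [_ weak_closed] /choice[j] /choice[x jxP].
have x1 n : rnorm (x n) <= 1 by have [_ _ ->] := jxP n.
(* Taking [j] as the growth parameter gives [j (s k) < s k.+1 <= j (s k.+1)], so the subspace
   indices increase strictly. *)
have [s [w [incr wc]]] := bounded_weak_cvg_subseq x 1 j x1.
have le_j m : (m <= j m)%N by have [] := jxP m.
have le_s k : (k <= s k)%N.
  elim: k => // k IH; apply: leq_ltn_trans IH (leq_ltn_trans (le_j _) _).
  exact: incr.
exists s, (j \o s), (x \o s), w; split=> // [k|k|].
- exact: leq_trans (le_s k) (le_j _).
- by have [] := jxP (s k).
- apply: (weak_closed (j \o s)) wc.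
    apply/increasing_seqP => k; apply: leq_trans (le_j (s k.+1)).
    exact: incr.
  by move=> k; have [] := jxP (s k).
Qed.

(** Otherwise unit vectors in [W_ (j_ k)] with [e <= |l|] would have a weak limit in [W], where [l]
    vanishes, although [l] is weakly continuous. *)
Lemma Mosco_annihilator_small (W_ : nat -> set H) (W : set H)
    (l : H -> R[i]) (e : R) : Mosco_cvg W_ W ->
  (forall j, closed_subspace (W_ j)) ->
  antilinear l -> continuous l -> (forall v, W v -> l v = 0) -> 0 < e ->
  exists J, forall j v, (J <= j)%N -> W_ j v -> rnorm (l v) <= e * rnorm v.
Proof.
move=> mosco cl lin lcont lW e0; apply: contrapT => /forallNP nJ.
have [|s [j_ [w_ [w [_ _ w_P wc Ww]]]]] :=
    Mosco_weak_limit W_ W (fun _ _ w => e <= rnorm (l w)) mosco.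
  move=> m; have /existsNP[j /existsNP[v]] := nJ m.
  move=> /not_implyP[mj /not_implyP[Wv /negP]]; rewrite -ltNge => lt.
  have v0 : 0 < rnorm v.
    rewrite lt_def rnorm_ge0 andbT; apply: contraPneq lt => /rnorm_eq0 ->.
    by rewrite antilinear0 // !rnorm0 mulr0 ltxx.
  exists j, (((rnorm v)^-1)%:C%C *: v); split=> //.
  - exact: closed_subspaceZ.
  - by rewrite rnormZ rnormR ?invr_ge0 // mulVf // gt_eqF.
  - rewrite -[_ *: v]addr0 lin antilinear0 // addr0 rnormM rnorm_conj.
    by rewrite rnormR ?invr_ge0 // mulrC ler_pdivlMr // ltW.
have := antilinear_weak_cvg l w_ w lin lcont wc; rewrite (lW w Ww).
move=> /rnorm_cvgP/(_ _ e0)/filter_ex[n /=].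
by rewrite sub0r rnormN ltNge; have [_ _ ->] := w_P n.
Qed.

(** Here [d] stands for any bound on the norm of [a u] restricted to [W_ j], in place of a
    supremum. *)
Lemma Mosco_lower_bound (W_ : nat -> set H) (W : set H) a :
  continuous_form a -> compactly_perturbed_coercive a -> Mosco_cvg W_ W ->
  (forall j, closed_subspace (W_ j)) ->
  (forall u, W u -> (forall v, W v -> a u v = 0) -> u = 0) ->
  exists (J : nat) (c : R), 0 < c /\
    forall j u d, (J <= j)%N -> W_ j u -> 0 <= d ->
      (forall v, W_ j v -> rnorm (a u v) <= d * rnorm v) -> c * rnorm u <= d.
Proof.
move=> acont [a0 [a1 [aE [_ [alpha alpha0 coer]] [_ comp]]]] mosco cl inj.
apply: contrapT => /forallNP nJ.
have [|s [j_ [w_ [w [le_s le_j w_P wc Ww]]]]] := Mosco_weak_limit W_ W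
    (fun m j w => forall v, W_ j v -> rnorm (a w v) <= m.+1%:R^-1 * rnorm v) mosco.
  (* The bound fails with threshold [m] and constant [1/(m+1)]; dividing the offending [u] by its
     norm gives the unit vector. *)
  move=> m; have /forallNP/(_ m.+1%:R^-1)/not_andP[|] := nJ m.
    by rewrite invr_gt0 ltr0n.
  move=> /existsNP[j /existsNP[u /existsNP[d]]].
  move=> /not_implyP[mj /not_implyP[Wu /not_implyP[d0 /not_implyP[le /negP]]]].
  rewrite -ltNge => lt; have u0 : 0 < rnorm u.
    rewrite lt_def rnorm_ge0 andbT; apply: contraPneq lt => ->.
    by rewrite mulr0 ltNge d0.
  exists j, (((rnorm u)^-1)%:C%C *: u); split=> // [||v Wv].
  - exact: closed_subspaceZ.
  - by rewrite rnormZ rnormR ?invr_ge0 // mulVf // gt_eqF.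
  - rewrite linearZl_LR /= rnormM rnormR ?invr_ge0 // mulrC ler_pdivrMr //.
    rewrite (le_trans (le v Wv)) // mulrAC ler_wpM2r //.
    by rewrite ltW.
have small k v : W_ (j_ k) v -> rnorm (a (w_ k) v) <= k.+1%:R^-1 * rnorm v.
  have [_ _ le] := w_P k; move=> /le/le_trans; apply.
  by rewrite ler_wpM2r // lef_pV2 ?posrE // ler_nat ltnS.
have w0 : w = 0.
  apply: inj => // v Wv; have [recovery _] := mosco.
  have [v_ Wv_ v_v] := recovery v Wv.
  (* Along a recovery sequence for [v], the values [a (w_ k) (v_ (j_ k))] tend both to [a w v] and
     to [0]. *)
  have vj_v : v_ (j_ k) @[k --> \oo] --> v.
    apply/rnorm_cvgP => e e0; have /rnorm_cvgP/(_ _ e0)[N _ Nlt] := v_v.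
    by exists N => // k /= Nk; apply: Nlt => /=; exact: leq_trans Nk (le_j k).
  have lim1 : a (w_ k) (v_ (j_ k)) @[k --> \oo] --> a w v.
    apply: (form_weak_strong_cvg a 1) => // k.
    by have [_ -> _] := w_P k.
  have lim0 : a (w_ k) (v_ (j_ k)) @[k --> \oo] --> (0 : R[i]).
    apply/rnorm_cvgP => e e0.
    have v1 : 0 < rnorm v + 1 by rewrite ltr_wpDl.
    have lt1 := near_inv_lt _ (divr_gt0 e0 v1).
    have /rnorm_cvgP/(_ 1 ltr01) := vj_v; apply: filterS2 lt1 => k lt1 lt2.
    rewrite sub0r rnormN (le_lt_trans (small k _ (Wv_ _))) //.
    move: lt1; rewrite ltr_pdivlMr //; apply: le_lt_trans; rewrite ler_wpM2l //.
    rewrite -[v_ _](subrK v) (le_trans (rnormD _ _)) // addrC lerD2l rnormC.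
    exact: ltW.
  exact: (cvg_unique (@norm_hausdorff _ _) lim1 lim0).
have a1_0 : a1 (w_ k) (w_ k) @[k --> \oo] --> (0 : R[i]).
  by have := comp _ _ _ _ wc wc; rewrite w0 linear0l.
(* For some [k], both [a] and [a1] at [(w_ k, w_ k)] are below [alpha / 2], so [a0] there is below
   [alpha], against coercivity on a unit vector. *)
have alpha2 : 0 < alpha / 2 by rewrite divr_gt0.
have /rnorm_cvgP/(_ _ alpha2) := a1_0.
move=> /(filterI (near_inv_lt _ alpha2))/filter_ex[k [/= lt1]].
rewrite sub0r rnormN => lt2.
have [Wk wk1 _] := w_P k; have := small k _ Wk; rewrite wk1 mulr1 => le.
have := coer (w_ k).
rewrite !rnormE -rmorphXn -rmorphM lecR wk1 expr1n mulr1 leNgt => /negP; apply.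
have -> : a0 (w_ k) (w_ k) = a (w_ k) (w_ k) - a1 (w_ k) (w_ k).
  by rewrite aE addrK.
rewrite (le_lt_trans (rnormD _ _)) // rnormN [alpha]splitr ltrD //.
exact: le_lt_trans lt1.
Qed.

End Mosco.

(** * Invertibility *)

Section Solvability.
Context {R : realType} {H : hilbertType R}.
Implicit Types (a : sesquilinear H H) (V : set H).

(** A closed range argument: the lower bound makes the set of attained right-hand sides closed, and
    injectivity in the second argument makes it dense. *)
Lemma form_solvable a V (c : R) : continuous_form a -> closed_subspace V ->
  0 < c ->
  (forall u d, V u -> 0 <= d ->
     (forall v, V v -> rnorm (a u v) <= d * rnorm v) -> c * rnorm u <= d) ->
  (forall v, V v -> (forall u, V u -> a u v = 0) -> v = 0) ->
  forall y, exists u, V u /\ forall v, V v -> a u v = inner y v.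
Proof.
move=> acont Vcl c0 lower inj y.
have [V0 lV clV] := (closed_subspaceP V).1 Vcl.
have [C C0 aC] := continuous_formP a acont.
(* [S] contains the orthogonal complement of [V], so a vector orthogonal to [S]
   lies in [V] and is annihilated by all [a u], whence it is [0]. *)
pose S := [set y | exists u, V u /\ forall v, V v -> a u v = inner y v].
have Scl : closed_subspace S.
  apply/closed_subspaceP.
  split=> [|d y1 y2 [u1 [Vu1 E1]] [u2 [Vu2 E2]]|y_ z Sy yz].
  - by exists 0; split=> // v _; rewrite !linear0l.
  - exists (d *: u1 + u2); split=> [|v Vv]; first exact: lV.
    by rewrite !linearDl !linearZl_LR /= E1 ?E2.
  - have /choice[u_ u_P] := Sy.
    have Vu n : V (u_ n) by have [] := u_P n.
    have [u uu] : exists u : H, u_ @ \oo --> u.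
      apply: rnorm_cauchy_cvg => e e0.
      (* On [V], [a (u_ n - u_ m)] is represented by [y_ n - y_ m], so the lower bound turns the
         Cauchy property of [y_] into that of [u_]. *)
      have ce : 0 < c * e / 2 by rewrite divr_gt0 ?mulr_gt0.
      have /rnorm_cvgP/(_ _ ce)[N _ Nlt] := yz.
      exists N => n m /Nlt /= ltn /Nlt /= ltm.
      rewrite -(ltr_pM2l c0).
      apply: (@le_lt_trans _ _ (rnorm (y_ n - y_ m))).
        apply: lower => // [|v Vv]; first exact: closed_subspaceB.
        rewrite linearBl /= (u_P n).2 // (u_P m).2 // -linearBl.
        exact: cauchy_schwarz.
      have -> : y_ n - y_ m = (z - y_ m) - (z - y_ n).
        by rewrite opprB [RHS]addrC addrA subrK.
      by rewrite (le_lt_trans (rnormD _ _)) // rnormN [c * e]splitr ltrD.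
    exists u; split=> [|v Vv]; first exact: clV uu.
    have au : a (u_ n) v @[n --> \oo] --> a u v.
      apply: (@rnorm_cvg_le _ _ _ _ _ _ _ _ u_ u (C * rnorm v)) => // n.
      by rewrite -linearBl (le_trans (aC _ _)) // mulrAC.
    have iy : a (u_ n) v @[n --> \oo] --> inner z v.
      apply: (cvg_ext _ _ _ _ (inner_cvgl v _ _ yz)) => n.
      by rewrite (u_P n).2.
    exact: (cvg_unique (@norm_hausdorff _ _) au iy).
have [p [[u [Vu uE]] ortho]] := projection S y Scl; set q := y - p in ortho.
have SV : forall w, (forall v, V v -> inner w v = 0) -> S w.
  by move=> w wV; exists 0; split=> // v Vv; rewrite linear0l wV.
have Vq : V q.
  have [p' [Vp' ortho']] := projection V q Vcl.
  suff /eqP : inner (q - p') (q - p') = 0.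
    by rewrite dnorm_eq0 subr_eq0 => /eqP->.
  rewrite [LHS]linearBl /= ortho ?sub0r; last exact: SV.
  by rewrite inner_conj ortho' // rmorph0 oppr0.
have q0 : q = 0.
  apply: inj => // w Vw.
  have [y' y'E] := riesz (a w) (antilinear_form a w)
    (continuous_form_continuous a w acont).
  by rewrite y'E inner_conj ortho ?rmorph0 //; exists w.
by exists u; split=> // v Vv; rewrite uE // -[y](subrK p) -/q q0 add0r.
Qed.

End Solvability.

(** * Annihilators, dual realisations and injectivity *)

Section Realisation.
Context {R : realType} {H HH : hilbertType R}.
Variables (pairing : sesquilinear HH H).
Implicit Types (a : sesquilinear H H) (W : set H).

Lemma annihilator_closed_subspace W :
  continuous_form pairing -> closed_subspace (annihilator pairing W).
Proof.
move=> /continuous_formP[C C0 le]; apply/closed_subspaceP.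
split=> [v _|c f g Wf Wg v Wv|f_ f Wf ff v Wv].
- by rewrite linear0l.
- by rewrite linearDl linearZl_LR /= Wf // Wg // mulr0 addr0.
- have pf : pairing (f_ n) v @[n --> \oo] --> pairing f v.
    apply: (@rnorm_cvg_le _ _ _ _ _ _ _ _ f_ f (C * rnorm v)) => // n.
    by rewrite -linearBl (le_trans (le _ _)) // mulrAC.
  have p0 : pairing (f_ n) v @[n --> \oo] --> (0 : R[i]).
    have c0 : (fun _ : nat => 0 : R[i]) @ \oo --> (0 : R[i]) by exact: cvg_cst.
    by apply: (cvg_ext _ _ _ _ c0) => n; rewrite Wf.
  exact: (cvg_unique (@norm_hausdorff _ _) pf p0).
Qed.

(** Subtracting from a representative its projection onto the annihilator of [W] leaves its values
    on [W] unchanged. *)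
Lemma dual_realisation_rep W (l : {linear H -> R[i] | Num.conj \; *%R}) :
  unitary_realisation pairing -> in_dual l ->
  exists f, dual_realisation pairing W f /\ forall v, W v -> pairing f v = l v.
Proof.
move=> [pcont _ _ psurj] /psurj[f fl].
have [p [Wp ortho]] := projection _ f (annihilator_closed_subspace W pcont).
exists (f - p); split=> // v Wv.
by rewrite linearBl /= fl Wp // subr0.
Qed.

Lemma invertible_on_inj a W : closed_subspace W -> invertible_on pairing a W ->
  forall u, W u -> (forall v, W v -> a u v = 0) -> u = 0.
Proof.
move=> /closed_subspaceP[W0 _ _] inv u Wu au0.
have d0 : dual_realisation pairing W 0 by move=> v _; rewrite linear0l.
have [w [_ uniq]] := inv 0 d0.
have <- : w = u by apply: uniq; split=> // v Wv; rewrite linear0l au0.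
by apply: uniq; split=> // v Wv; rewrite !linear0l.
Qed.

(** Solve with right-hand side [inner v] and test with [v] itself: [inner v v = a u v = 0]. *)
Lemma invertible_on_adjoint_inj a W : unitary_realisation pairing ->
  invertible_on pairing a W ->
  forall v, W v -> (forall u, W u -> a u v = 0) -> v = 0.
Proof.
move=> real inv v Wv av0.
have [f [df fv]] := dual_realisation_rep W (inner v) real (inner_continuous v).
have [u [[Wu uf] _]] := inv f df.
by apply/eqP; rewrite -(dnorm_eq0 inner) -fv // -uf // av0.
Qed.

End Realisation.

Section Adjoint.
Context {R : realType} {H : hilbertType R}.
Implicit Types (a : sesquilinear H H).

Lemma compactly_perturbed_coercive_adjoint a :
  compactly_perturbed_coercive a -> compactly_perturbed_coercive (adjoint_form a).
Proof.
move=> [a0 [a1 [aE [c0 [alpha alpha0 coer]] [c1 comp]]]].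
exists (adjoint_form a0), (adjoint_form a1); split.
- by move=> u v; rewrite /= /adjoint_form aE rmorphD.
- split; first exact: continuous_adjoint_form.
  by exists alpha => // u; rewrite /= /adjoint_form norm_conjC.
- split; first exact: continuous_adjoint_form.
  move=> u_ v_ u v uu vv.
  apply: (@rnorm_cvg_le _ _ _ _ _ _ _ _ _ _ 1) (comp v_ u_ v u vv uu) => n.
  by rewrite mul1r /= /adjoint_form -rmorphB rnorm_conj.
Qed.

End Adjoint.

(** * Uniform invertibility and convergence of solutions *)

Theorem lemma2p5 (R : realType) (H HH : hilbertType R)
    (pairing : sesquilinear HH H) (a : sesquilinear H H)
    (W : set H) (W_ : nat -> set H) :
  unitary_realisation pairing ->
  continuous_form a ->
  closed_subspace W ->
  (forall j, closed_subspace (W_ j)) ->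
  Mosco_cvg W_ W ->
  compactly_perturbed_coercive a ->
  invertible_on pairing a W ->
  exists J : nat,
    uniformly_invertible_on pairing a (fun j => W_ (J + j)%N) /\
    forall (f : HH) (u : H) (u_ : nat -> H),
      is_solution pairing a W f u ->
      (forall j, (J <= j)%N -> is_solution pairing a (W_ j) f (u_ j)) ->
      u_ @ \oo --> u.
Proof.
move=> real acont Wcl cl mosco cpc inv.
have [pcont pdual _ _] := real.
have [C C0 pC] := continuous_formP pairing pcont.
have [J1 [c [c0 lower]]] := Mosco_lower_bound W_ W a acont cpc mosco cl
  (invertible_on_inj pairing a W Wcl inv).
have [|J2 [c' [c'0 lower']]] := Mosco_lower_bound W_ W (adjoint_form a)
  (continuous_adjoint_form a acont) (compactly_perturbed_coercive_adjoint a cpc)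
  mosco cl.
  move=> v Wv av0; apply: (invertible_on_adjoint_inj pairing a W real inv v Wv).
  by move=> u Wu; apply: (can_inj (@conjCK _)); rewrite rmorph0; exact: av0.
(* Injectivity on [W_ j], for the adjoint and then for [a], is the lower bound with [d = 0]. *)
have inj' j v : (J2 <= j)%N -> W_ j v ->
    (forall u, W_ j u -> a u v = 0) -> v = 0.
  move=> jJ Wv av0; apply: rnorm_eq0; apply/eqP; rewrite eq_le rnorm_ge0 andbT.
  rewrite -(ler_pM2l c'0) mulr0; apply: (lower' j) => // u Wu.
  by rewrite /= /adjoint_form av0 // rmorph0 rnorm0 mul0r.
have inj j u : (J1 <= j)%N -> W_ j u ->
    (forall v, W_ j v -> a u v = 0) -> u = 0.
  move=> jJ Wu au0; apply: rnorm_eq0; apply/eqP; rewrite eq_le rnorm_ge0 andbT.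
  rewrite -(ler_pM2l c0) mulr0; apply: (lower j) => // v Wv.
  by rewrite au0 // rnorm0 mul0r.
exists (maxn J1 J2); split.
  have leJ1 j : (J1 <= maxn J1 J2 + j)%N.
    by rewrite (leq_trans (leq_maxl _ J2)) ?leq_addr.
  have leJ2 j : (J2 <= maxn J1 J2 + j)%N.
    by rewrite (leq_trans (leq_maxr J1 _)) ?leq_addr.
  split=> [j f _|].
    have [y yE] := riesz (pairing f) (antilinear_form pairing f) (pdual f).
    have [u [Wu uE]] := form_solvable a _ c acont (cl _) c0
      (fun u d => lower _ u d (leJ1 j)) (fun v => inj' _ v (leJ2 j)) y.
    exists u; split; first by split=> // v Wv; rewrite uE.
    move=> w [Ww wE]; apply/eqP; rewrite -subr_eq0; apply/eqP.
    apply: (inj _ _ (leJ1 j)) => [|v Wv]; first exact: closed_subspaceB.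
    by rewrite linearBl /= wE // uE // yE subrr.
  (* [C] is the continuity constant of the pairing, so [d = C * rnorm f] is admissible in the lower
     bound. *)
  exists (C / c); first by rewrite divr_gt0.
  move=> j f u _ [Wu uE]; rewrite !rnormE -rmorphM lecR.
  rewrite mulrAC ler_pdivlMr // mulrC; apply: (lower _ u _ (leJ1 j)) => // [|v Wv].
    by rewrite mulr_ge0 // ltW.
  by rewrite uE.
move=> f u u_ [Wu uE] u_P.
pose l v := pairing f v - a u v.
have lin : antilinear l.
  move=> d v w; rewrite /l antilinear_form (antilinear_form a).
  by rewrite opprD addrACA mulrBr.
have lcont : continuous l.
  move=> v; apply: cvgB; first exact: pdual.
  exact: continuous_form_continuous.
have lW v : W v -> l v = 0 by move=> Wv; rewrite /l uE // subrr.
have [recovery _] := mosco; have [w_ Ww_ w_u] := recovery u Wu.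
have [Ca Ca0 aC] := continuous_formP a acont.
apply/rnorm_cvgP => e e0.
(* The error splits as [e / 2] for [u - w_ n] and [e / 2] for [w_ n - u_ n]. For the latter the
   lower bound allows [c * (e / 2)], shared equally between [l] and [a (u - w_ n)]; dividing by [Ca]
   serves the second share. *)
have e2 : 0 < c * (e / 2) / 2 by rewrite divr_gt0 ?mulr_gt0 ?divr_gt0.
have [J lJ] := Mosco_annihilator_small W_ W l _ mosco cl lin lcont lW e2.
have e3 : 0 < Num.min (e / 2) (c * (e / 2) / 2 / Ca).
  by rewrite lt_min !divr_gt0 // mulr_gt0 // divr_gt0.
have /rnorm_cvgP/(_ _ e3) := w_u; apply: filter_app; near=> n.
rewrite lt_min => /andP[lt1 lt2].
have Jn : (maxn J1 J2 <= n)%N by near: n; exists (maxn J1 J2).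
have JJn : (J <= n)%N by near: n; exists J.
have J1n : (J1 <= n)%N := leq_trans (leq_maxl _ _) Jn.
have [Wun unE] := u_P n Jn.
have : c * rnorm (w_ n - u_ n) <= c * (e / 2).
  apply: (lower n) => // [||v Wv].
  - exact: closed_subspaceB.
  - by rewrite mulr_ge0 ?divr_ge0 // ltW.
  have -> : a (w_ n - u_ n) v = - (a (u - w_ n) v + l v).
    by rewrite !linearBl /= unE // /l; ring.
  rewrite rnormN (le_trans (rnormD _ _)) // [c * (e / 2)]splitr mulrDl lerD //.
    rewrite (le_trans (aC _ _)) // ler_wpM2r // mulrC -ler_pdivlMr //.
    exact: ltW.
  exact: (lJ n v JJn Wv).
rewrite ler_pM2l // => le.
rewrite -(subrK (w_ n) u) -addrA [e]splitr.
by rewrite (le_lt_trans (rnormD _ _)) // ltr_leD.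
Unshelve. all: by end_near. Qed.
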